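(* Let $\Omega\subset\mathbb{C}$ be a domain, $V\subset\Omega$ a bounded open set and $p\in[1,\infty)$. Let $Y(\Omega,V,p)=\{f\in H(\Omega):\int_V|f|^p<\infty\}$, where the integral is with respect to planar Lebesgue measure. If for every $\zeta\in\overline{V}\cap\partial\Omega$ there exist points of $\mathbb{C}\setminus\overline{\Omega}$ arbitrarily close to $\zeta$, then $\Omega$ is a $Y(\Omega,V,p)$-domain of holomorphy.
   Context: A domain is a nonempty open connected set; $H(\Omega)$ is the set of holomorphic functions $\Omega\to\mathbb{C}$; closures and boundaries are taken in $\mathbb{C}$. A holomorphic function $f:\Omega\to\mathbb{C}$ is extendable if there exist an open connected set $U\subset\mathbb{C}$ with $U\cap\Omega\neq\emptyset$ and $U\cap\Omega^{\mathrm c}\neq\emptyset$, a holomorphic function $F:U\to\mathbb{C}$ and a connected component $W$ of $U\cap\Omega$ such that $F|_W=f|_W$. Otherwise $f$ is non-extendable. For $X\subset H(\Omega)$, $\Omega$ is called an $X$-domain of holomorphy if there exists $f\in X$ which is non-extendable. *)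

(* Defs.v *)
From HB Require Import structures.
From mathcomp Require Import all_boot all_order all_algebra.
From mathcomp Require Import complex.
From mathcomp Require Import all_classical all_reals all_analysis.

Set Implicit Arguments.
Unset Strict Implicit.
Unset Printing Implicit Defensive.

Import Order.TTheory GRing.Theory Num.Theory.
Import numFieldNormedType.Exports.

Local Open Scope classical_set_scope.
Local Open Scope ring_scope.

(* The complex numbers are [R[i]^o] with [R : realType]: the [^o] selects the
   topology and the normed [R[i]]-module structure induced by the modulus.
   Functions defined on a set [Omega] are represented by total functions of
   which only the values on [Omega] are used. *)

Definition is_domain (R : realType) (Omega : set R[i]^o) : Prop :=
  [/\ Omega !=set0, open Omega & connected Omega].

Definition boundary (R : realType) (A : set R[i]^o) : set R[i]^o :=
  closure A `\` interior A.

(* As the scalar field is [R[i]], derivability in the direction 1 is complex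
   differentiability.  Meant for an open [Omega], on which it only depends on
   the restriction of [f] to [Omega]. *)
Definition holomorphic (R : realType) (Omega : set R[i]^o)
    (f : R[i]^o -> R[i]^o) : Prop :=
  forall z, Omega z -> derivable f z 1.

Definition is_component (R : realType) (W A : set R[i]^o) : Prop :=
  exists2 x, A x & W = connected_component A x.

Definition extendable (R : realType) (Omega : set R[i]^o)
    (f : R[i]^o -> R[i]^o) : Prop :=
  exists (U : set R[i]^o) (F : R[i]^o -> R[i]^o) (W : set R[i]^o),
    [/\ open U /\ connected U,
        U `&` Omega !=set0 /\ U `&` ~` Omega !=set0,
        holomorphic U F,
        is_component W (U `&` Omega) &
        forall z, W z -> F z = f z].

Definition domain_of_holomorphy (R : realType) (Omega : set R[i]^o)
    (X : set (R[i]^o -> R[i]^o)) : Prop :=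
  exists2 f, X f & ~ extendable Omega f.

(* Planar Lebesgue measure is the product measure on [R * R], carried to
   [R[i]] by (x, y) |-> x + iy; [Normc.normc] is the [R]-valued modulus. *)
Definition integral_normX (R : realType) (V : set R[i]^o) (p : R)
    (f : R[i]^o -> R[i]^o) : \bar R :=
  (\int[lebesgue_measure \x lebesgue_measure]_(w in
       [set w : R * R | V (w.1 +i* w.2)%C])
     ((Normc.normc (f (w.1 +i* w.2)%C)) `^ p)%:E)%E.

Definition Y (R : realType) (Omega V : set R[i]^o) (p : R) :
    set (R[i]^o -> R[i]^o) :=
  [set f | holomorphic Omega f /\ (integral_normX V p f < +oo)%E].

(* Main.v *)
Require Import Defs.
From HB Require Import structures.
From mathcomp Require Import all_boot all_order all_algebra.
From mathcomp Require Import complex.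
From mathcomp Require Import all_classical all_reals all_analysis.
From mathcomp Require Import ring lra.

Import Order.TTheory GRing.Theory Num.Theory.
Import numFieldNormedType.Exports.

Local Open Scope classical_set_scope.
Local Open Scope ring_scope.

(** Call a point admissible if it lies outside Omega and outside the closure of
    V.  By hypothesis, admissible points accumulate at every boundary point of
    Omega: near a boundary point in the closure of V there are exterior points
    of Omega, and any other boundary point is itself admissible.  If w is admissible, 1 / (w - z) is holomorphic on Omega and
    bounded on V.  The function sought is a series f(z) = sum_k c_k / (w_k - z)
    with admissible poles w_k and c_k >= 0 so small that the series converges
    locally uniformly on Omega and is bounded on V; as V is bounded, f is then
    in Y for every p.

    The c_k have to be chosen so that f does not extend.  A boundary point may
    be separated from the nearby poles by other parts of the boundary, so f may
    well stay bounded there, and one argues with Taylor coefficients instead.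
    If F on U extends f from a component W of the intersection of U and Omega,
    then W has a boundary point zeta in U that is not in Omega
    ([component_boundary]).  Around every point z0 of W near zeta, F is
    holomorphic on a square of fixed half-side s, and the Cauchy estimate bounds the n-th Taylor coefficient
    sum_k c_k / (w_k - z0)^(n+1) of f at z0 by C (3 / s)^n
    ([taylor_coefficient_le]).  Taking z0 and the remaining parameters
    rational, only countably many estimates of this kind have to be violated.
    Each of them is violated by some 1 / (w - z) with w admissible close to
    zeta, since w is then closer to z0 than s / 3, and [gliding_hump] chooses
    the c_k one after the other so that f violates them all.

    The Cauchy estimate rests on a maximum principle with a constant,
    |A| <= 2 max |A + (z - z0) G(z)| over the boundary of a square centred at
    z0, for G complex differentiable on the square ([weak_maximum]).  Applied
    to successive divided differences it bounds the Taylor coefficients one by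
    one; the constant only costs a fixed factor in the radius, which is
    harmless.  It follows from the Goursat lemma on squares
    ([goursat_square]), proved by bisection. *)

Local Notation nc := Normc.normc.
Local Notation Re := complex.Re.
Local Notation Im := complex.Im.

(** * The modulus and complex differentiability *)

Section Modulus.
Context {R : realType}.
Implicit Types x y z : R[i].

Lemma normE x : `|x| = (nc x)%:C%C.
Proof. by []. Qed.

Lemma normc_ge0 x : 0 <= nc x.
Proof. by case: x => a b; rewrite sqrtr_ge0. Qed.

Lemma normc_eq0 x : (nc x == 0) = (x == 0).
Proof.
apply/eqP/eqP => [/Normc.eq0_normc //|->]; exact: Normc.normc0.
Qed.

Lemma normc_gt0 x : (0 < nc x) = (x != 0).
Proof. by rewrite lt_neqAle normc_ge0 andbT eq_sym normc_eq0. Qed.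

Lemma normcB x y : nc (x - y) = nc (y - x).
Proof. by rewrite -normcN opprB. Qed.

Lemma normc_leB x y : nc x - nc y <= nc (x - y).
Proof. by rewrite lerBlDr -{1}(subrK y x) le_normcD. Qed.

Lemma normcX x n : nc (x ^+ n) = nc x ^+ n.
Proof. by elim: n => [|n IH]; rewrite ?expr0 ?Normc.normc1// !exprS Normc.normcM IH. Qed.

Lemma normcR (r : R) : nc r%:C%C = `|r|.
Proof. by rewrite /= expr0n addr0 sqrtr_sqr. Qed.

Lemma normc_Re x : `|complex.Re x| <= nc x.
Proof. by have := normc_ge_Re x; rewrite normE lecR. Qed.

Lemma normc_Im x : `|complex.Im x| <= nc x.
Proof.
case: x => a b /=; rewrite -sqrtr_sqr ler_wsqrtr// lerDr; exact: sqr_ge0.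
Qed.

Lemma normc_le_ReIm x : nc x <= `|complex.Re x| + `|complex.Im x|.
Proof.
case: x => a b /=; have h : 0 <= `|a| + `|b| by rewrite addr_ge0.
rewrite -(ger0_norm h) -sqrtr_sqr ler_wsqrtr// sqrrD !real_normK ?num_real//.
by rewrite lerD2r lerDl mulrn_wge0// mulr_ge0.
Qed.

Lemma posc_real (e : R[i]) : 0 < e -> exists2 r : R, 0 < r & e = r%:C%C.
Proof.
case: e => a b; rewrite ltcE /= => /andP[/eqP b0 a0]; exists a => //.
by rewrite b0.
Qed.

Lemma nbhs_normc (z : R[i]^o) (A : set R[i]^o) :
  nbhs z A <-> exists2 r : R, 0 < r & forall y : R[i], nc (y - z) < r -> A y.
Proof.
split=> [/nbhs_normP[e /= /posc_real[r r0 ->] h]|[r r0 h]].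
  exists r => // y yz; apply: h => /=.
  by rewrite /ball_ /= normE normcB ltcR.
apply: (proj2 (nbhs_normP z A)); exists (r%:C%C); first by rewrite /= ltcR.
by move=> y; rewrite /ball_ /= normE normcB ltcR; exact: h.
Qed.

Lemma openc (A : set R[i]^o) (z : R[i]) : open A -> A z ->
  exists2 r : R, 0 < r & forall y : R[i], nc (y - z) < r -> A y.
Proof. by move=> oA Az; apply/nbhs_normc; apply: open_nbhs_nbhs. Qed.

(** Real epsilons and the real-valued modulus make the condition usable for
    the real and imaginary parts separately. *)
Lemma derivablecP (f : R[i]^o -> R[i]^o) (z : R[i]) : derivable f z 1 <->
  exists D : R[i], forall e : R, 0 < e -> exists2 d : R, 0 < d &
    forall h : R[i], nc h < d -> nc (f (z + h) - f z - D * h) <= e * nc h.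
Proof.
have q (D h : R[i]) : h != 0 ->
    nc (D - h^-1 * (f (h * 1 + z) - f z)) * nc h = nc (f (z + h) - f z - D * h).
  move=> h0; rewrite -Normc.normcM mulrBl mulrAC mulVf// mul1r mulr1.
  by rewrite (addrC h) normcB.
split=> [/cvg_ex[D /cvgrPdist_le cD]|[D hD]].
  exists D => e e0; have /nbhs_normc[d d0 hd] := cD e%:C%C (etrans (ltcR _ _) e0).
  exists d => // h hd'; have [->|h0] := eqVneq h 0.
    by rewrite addr0 subrr mulr0 subr0 Normc.normc0 mulr0.
  rewrite -q// ler_wpM2r ?normc_ge0//.
  have := hd h; rewrite subr0 => /(_ hd' h0).
  by rewrite normE lecR.
apply/cvg_ex; exists D; apply/cvgrPdist_le => _ /posc_real[e e0 ->].
have [d d0 hd] := hD e e0; apply/nbhs_normc; exists d => // h.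
rewrite subr0 => hd' h0; rewrite normE lecR.
by rewrite -(ler_pM2r (x := nc h)) ?normc_gt0// q// hd.
Qed.

End Modulus.

(** * Goursat lemma on squares *)

Section Bisection.
Context {R : realType}.

Lemma nested_intervals (a b : nat -> R) :
  (forall n, a n <= a n.+1) -> (forall n, b n.+1 <= b n) ->
  (forall n, a n <= b n) -> exists x, forall n, a n <= x <= b n.
Proof.
move=> ai bd ab.
have aI : {homo a : m n / (m <= n)%N >-> m <= n} by apply/nondecreasing_seqP.
have bD : {homo b : m n / (m <= n)%N >-> n <= m} by apply/nonincreasing_seqP.
have amb m n : a m <= b n.
  apply: le_trans (aI _ _ (leq_maxl m n)) _.
  by apply: le_trans (ab _) (bD _ _ (leq_maxr m n)).
exists (sup (range a)) => n; apply/andP; split.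
  apply: ub_le_sup; last by exists n.
  by exists (b 0%N) => _ [m _ <-].
apply: ge_sup; first by exists (a 0%N), 0%N.
by move=> _ [m _ <-].
Qed.

Lemma small_halves (s d : R) : 0 < d -> exists n, s / 2 ^+ n < d.
Proof.
move=> d0; pose n := Num.bound `|s / d|; exists n.
rewrite ltr_pdivrMr ?exprn_gt0// -ltr_pdivrMl// mulrC.
apply: le_lt_trans (ler_norm _) _; apply: lt_trans (archi_boundP _) _ => //.
by rewrite -natrX ltr_nat ltn_expl.
Qed.

Definition in_square (a c s x y : R) := (a <= x <= a + s) && (c <= y <= c + s).

(** If a property that a square inherits from its four quarters fails for one
    square, it fails for a decreasing sequence of squares, hence for arbitrarily
    small squares around their common point. *)
Lemma square_bisection (P : R -> R -> R -> Prop) (a0 c0 s0 : R) : 0 < s0 ->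
  (forall a c s, 0 < s -> P a c (s / 2) -> P (a + s / 2) c (s / 2) ->
     P a (c + s / 2) (s / 2) -> P (a + s / 2) (c + s / 2) (s / 2) ->
     P a c s) ->
  (forall x y, in_square a0 c0 s0 x y -> exists2 d, 0 < d &
     forall a c s, 0 < s < d -> in_square a c s x y -> P a c s) ->
  P a0 c0 s0.
Proof.
move=> s00 Pq Pl; apply: contrapT => nP0.
pose T := (R * R * R)%type; pose bad (t : T) := 0 < t.2 /\ ~ P t.1.1 t.1.2 t.2.
have step (t : T) : exists t' : T, bad t -> [/\ bad t', t'.2 = t.2 / 2,
    t.1.1 <= t'.1.1 <= t.1.1 + t.2 / 2 & t.1.2 <= t'.1.2 <= t.1.2 + t.2 / 2].
  have [[t0 nPt]|nb] := pselect (bad t); last by exists t.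
  case: t t0 nPt => [[a c] s] /= s_gt0 nPt.
  have : ~ (forall a' c', (a' = a \/ a' = a + s / 2) ->
      (c' = c \/ c' = c + s / 2) -> P a' c' (s / 2)).
    by move=> h; apply: nPt; apply: Pq => //; apply: h; tauto.
  move=> /existsNP[a' /existsNP[c' /not_implyP[ha /not_implyP[hc nP]]]].
  exists (a', c', s / 2) => _; split => //=; first by split => //=; lra.
    by case: ha => ->; lra.
  by case: hc => ->; lra.
have [st hst] := choice step.
pose u n := iter n st (a0, c0, s0).
have ub n : bad (u n) by elim: n => [//|n IH]; have [] := hst _ IH.
have us n : (u n).2 = s0 / 2 ^+ n.
  elim: n => [|n IH]; first by rewrite expr0 divr1.
  by have [_ + _ _] := hst _ (ub n); rewrite /= => ->; rewrite IH exprSr invfM mulrA.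
have [x hx] : exists x, forall n, (u n).1.1 <= x <= (u n).1.1 + (u n).2.
  by apply: nested_intervals => n; have [b' e h1 h2] := hst _ (ub n);
    have [? _] := ub n; rewrite ?[(u n.+1).2]e -/(u n.+1); move: h1; rewrite -/(u n.+1); lra.
have [y hy] : exists x, forall n, (u n).1.2 <= x <= (u n).1.2 + (u n).2.
  by apply: nested_intervals => n; have [b' e h1 h2] := hst _ (ub n);
    have [? _] := ub n; rewrite ?[(u n.+1).2]e -/(u n.+1); move: h2; rewrite -/(u n.+1); lra.
have [|d d0 hd] := Pl x y; first by rewrite /in_square (hx 0%N) (hy 0%N).
have [n hn] := small_halves s0 d d0.
have [s_gt0 nP] := ub n; apply: nP; apply: hd; first by rewrite s_gt0 us.
by rewrite /in_square hx hy.
Qed.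

End Bisection.

Section Goursat.
Context {R : realType}.
Notation mu := (@lebesgue_measure R).
Implicit Types (f g : R -> R) (p q : R -> R -> R).

Notation integ f a b := (\int[mu]_(x in `[a, b]) f x).

Lemma integrable_segment f a b : {within `[a, b], continuous f} ->
  mu.-integrable `[a, b] (EFin \o f).
Proof. by move=> cf; apply: continuous_compact_integrable => //; exact: segment_compact. Qed.

Lemma int_ge f (K a b : R) : a <= b -> {within `[a, b], continuous f} ->
  (forall x, a <= x <= b -> K <= f x) -> K * (b - a) <= integ f a b.
Proof.
move=> ab cf fK.
have <- : \int[mu]_(x in `[a, b]) K = K * (b - a).
  rewrite Rintegral_cst//= lebesgue_measure_itv/= lte_fin.
  by move: ab; rewrite le_eqVlt => /predU1P[->|->//]; rewrite ltxx subrr.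
apply: le_Rintegral; first exact: measurable_itv.
- by apply: (integrable_segment (cst K)); apply: continuous_subspaceT; exact: cst_continuous.
- exact: integrable_segment.
- by move=> x; rewrite /= in_itv /= => /fK.
Qed.

Lemma int_split f a m b : {within `[a, b], continuous f} ->
  a <= m <= b -> integ f a b = integ f a m + integ f m b.
Proof.
move=> cf /andP[am mb]; have fi := integrable_segment _ _ _ cf.
have := @Rintegral_itvB R f (BLeft a) (BRight b) m fi.
rewrite !bnd_simp => /(_ am mb) /eqP; rewrite subr_eq => /eqP ->.
rewrite addrC Rintegral_itv_obnd_cbnd//.
by apply: integrableS fi => //; apply: subset_itv; rewrite bnd_simp.
Qed.

Lemma intB f g a b : {within `[a, b], continuous f} ->
  {within `[a, b], continuous g} ->
  integ (fun x => f x - g x) a b = integ f a b - integ g a b.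
Proof. by move=> cf cg; rewrite RintegralB//; exact: integrable_segment. Qed.

(** The integral of p dx + q dy along the boundary, counterclockwise, of the
    square with lower left corner (a, c) and side s. *)
Definition circulation p q (a c s : R) :=
  integ (p^~ c) a (a + s) - integ (p^~ (c + s)) a (a + s) +
  (integ (q (a + s)) c (c + s) - integ (q a) c (c + s)).

(** The form p dx + q dy is differentiable and closed at (x0, y0): the
    y-derivative of p and the x-derivative of q have the common value p2. *)
Definition closed_at p q (x0 y0 : R) := exists p1 p2 q2 : R,
  forall e, 0 < e -> exists2 d, 0 < d & forall x y,
    `|x - x0| < d -> `|y - y0| < d ->
    `|p x y - p x0 y0 - p1 * (x - x0) - p2 * (y - y0)|
       <= e * (`|x - x0| + `|y - y0|) /\
    `|q x y - q x0 y0 - p2 * (x - x0) - q2 * (y - y0)|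
       <= e * (`|x - x0| + `|y - y0|).

Lemma affine_approx_cvg f (k x0 : R) :
  (exists2 d, 0 < d & forall x, `|x - x0| < d ->
      `|f x - f x0 - k * (x - x0)| <= `|x - x0|) -> {for x0, continuous f}.
Proof.
move=> [d d0 h]; apply/cvgrPdist_le => e e0.
pose K := `|k| + 1; have K0 : 0 < K by rewrite ltr_wpDl.
apply/nbhs_normP; exists (Num.min d (e / K)); first by rewrite /= lt_min d0 divr_gt0.
move=> x; rewrite /ball_ /= lt_min distrC => /andP[xd xe].
rewrite distrC; have := h x xd => hx.
have : `|f x - f x0| <= K * `|x - x0|.
  rewrite -[f x - f x0](subrK (k * (x - x0))).
  apply: le_trans (ler_normD _ _) _.
  by rewrite normrM mulrDl mul1r addrC lerD2l.
move=> /le_trans; apply; rewrite mulrC -ler_pdivlMr//; exact: ltW.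
Qed.

Lemma closed_at_continuousl p q x0 y0 : closed_at p q x0 y0 ->
  {for x0, continuous (p^~ y0)}.
Proof.
move=> [p1 [p2 [q2 /(_ 1 ltr01)[d d0 h]]]]; apply: (affine_approx_cvg _ p1).
exists d => // x xd; have := h x y0 xd; rewrite subrr normr0 => /(_ d0)[+ _].
by rewrite mulr0 subr0 addr0 mul1r.
Qed.

Lemma closed_at_continuousr p q x0 y0 : closed_at p q x0 y0 ->
  {for y0, continuous (q x0)}.
Proof.
move=> [p1 [p2 [q2 /(_ 1 ltr01)[d d0 h]]]]; apply: (affine_approx_cvg _ q2).
exists d => // x xd; have := h x0 x; rewrite subrr normr0 => /(_ d0 xd)[_].
by rewrite mulr0 subr0 add0r mul1r.
Qed.

Lemma closed_at_withinl p q a c s y : c <= y <= c + s ->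
  (forall x y, in_square a c s x y -> closed_at p q x y) ->
  {within `[a, a + s], continuous (p^~ y)}.
Proof.
move=> hy cl; apply: continuous_in_subspaceT => x; rewrite inE /= in_itv /= => hx.
by apply: (closed_at_continuousl p q); apply: cl; rewrite /in_square hx hy.
Qed.

Lemma closed_at_withinr p q a c s x : a <= x <= a + s ->
  (forall x y, in_square a c s x y -> closed_at p q x y) ->
  {within `[c, c + s], continuous (q x)}.
Proof.
move=> hx cl; apply: continuous_in_subspaceT => y; rewrite inE /= in_itv /= => hy.
by apply: (closed_at_continuousr p q); apply: cl; rewrite /in_square hx hy.
Qed.

Lemma circulation_quarters p q a c t : 0 < t ->
  (forall x y, in_square a c (t + t) x y -> closed_at p q x y) ->
  circulation p q a c (t + t) =
    circulation p q a c t + circulation p q (a + t) c t +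
    (circulation p q a (c + t) t + circulation p q (a + t) (c + t) t).
Proof.
move=> t0 cl.
have P y : c <= y <= c + (t + t) -> integ (p^~ y) a (a + (t + t)) =
    integ (p^~ y) a (a + t) + integ (p^~ y) (a + t) (a + t + t).
  move=> hy; rewrite (int_split _ _ (a + t)) ?addrA//; last by lra.
  by rewrite -addrA; exact: closed_at_withinl hy cl.
have Q x : a <= x <= a + (t + t) -> integ (q x) c (c + (t + t)) =
    integ (q x) c (c + t) + integ (q x) (c + t) (c + t + t).
  move=> hx; rewrite (int_split _ _ (c + t)) ?addrA//; last by lra.
  by rewrite -addrA; exact: closed_at_withinr hx cl.
rewrite /circulation !P ?Q ?addrA; try lra.
Qed.

(** Opposite sides are compared pointwise: up to errors of order e * s, both
    p from bottom to top and q from left to right increase by p2 * s.  The two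
    increments enter the circulation with opposite signs and cancel, so no
    integral of an affine function has to be computed. *)
Lemma circulation_near p q x0 y0 (e : R) : 0 < e -> closed_at p q x0 y0 ->
  exists2 d, 0 < d & forall a c s, 0 < s < d -> in_square a c s x0 y0 ->
    (forall x y, in_square a c s x y -> closed_at p q x y) ->
    - (8 * e) * s ^+ 2 <= circulation p q a c s.
Proof.
move=> e0 [p1 [p2 [q2 /(_ e e0)[d d0 h]]]]; exists d => // a c s /andP[s0 sd] hxy cl.
have [hp hq] : (forall x y, in_square a c s x y -> 
    `|p x y - p x0 y0 - p1 * (x - x0) - p2 * (y - y0)| <= 2 * e * s) /\
  (forall x y, in_square a c s x y ->
    `|q x y - q x0 y0 - p2 * (x - x0) - q2 * (y - y0)| <= 2 * e * s).
  have H x y : in_square a c s x y -> `|x - x0| <= s /\ `|y - y0| <= s.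
    by move: hxy; rewrite /in_square !ler_norml => h1 h2; split; lra.
  split=> x y /H[hx hy];
    have [hp hq] := h x y (le_lt_trans hx sd) (le_lt_trans hy sd).
    by apply: le_trans hp _; have := ler_wpM2l (ltW e0) (lerD hx hy); lra.
  by apply: le_trans hq _; have := ler_wpM2l (ltW e0) (lerD hx hy); lra.
have ss : a <= a + s by lra.
have cs : c <= c + s by lra.
have cp y (hy : c <= y <= c + s) := closed_at_withinl _ _ _ _ _ _ hy cl.
have cq x (hx : a <= x <= a + s) := closed_at_withinr _ _ _ _ _ _ hx cl.
rewrite /circulation -!intB; [|by apply: cq; lra|by apply: cq; lra|by apply: cp; lra|by apply: cp; lra].
have I1 : (- p2 * s - 4 * e * s) * (a + s - a) <= integ (fun x => p x c - p x (c + s)) a (a + s).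
  apply: int_ge => //.
    by move=> x; apply: cvgB; [apply: (cp c)|apply: (cp (c + s))]; lra.
  move=> x hx; have := hp x c; have := hp x (c + s); rewrite /in_square hx !lexx cs /=.
  move=> /(_ isT) /[swap] /(_ isT); rewrite !ler_norml; lra.
have I2 : (p2 * s - 4 * e * s) * (c + s - c) <= integ (fun y => q (a + s) y - q a y) c (c + s).
  apply: int_ge => //.
    by move=> y; apply: cvgB; [apply: (cq (a + s))|apply: (cq a)]; lra.
  move=> y hy; have := hq (a + s) y; have := hq a y; rewrite /in_square hy !lexx ss /=.
  move=> /(_ isT) /[swap] /(_ isT); rewrite !ler_norml; lra.
apply: le_trans (lerD I1 I2); lra.
Qed.

(** A negative circulation would, by bisection, be at most a fixed negative
    multiple of s^2 on arbitrarily small squares, against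
    [circulation_near]. *)
Theorem goursat_square p q (a0 c0 s0 : R) : 0 < s0 ->
  (forall x y, in_square a0 c0 s0 x y -> closed_at p q x y) ->
  0 <= circulation p q a0 c0 s0.
Proof.
move=> s00 cl; rewrite leNgt; apply/negP => neg.
set k := - circulation p q a0 c0 s0; have k0 : 0 < k by rewrite oppr_gt0.
(* With this e the bound -8 e s0^2 is half of the circulation -k. *)
pose e := k / (16 * s0 ^+ 2).
have e0 : 0 < e by rewrite divr_gt0// mulr_gt0// exprn_gt0.
pose sub a c s := forall x y, in_square a c s x y -> in_square a0 c0 s0 x y.
have : sub a0 c0 s0 -> - (8 * e) * s0 ^+ 2 <= circulation p q a0 c0 s0.
  apply: (square_bisection (fun a c s => sub a c s ->
    - (8 * e) * s ^+ 2 <= circulation p q a c s)) => // [a c s s_gt0|x y hxy].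
    move=> h1 h2 h3 h4 hs; set t := s / 2; have st : s = t + t by rewrite /t; lra.
    move: h1 h2 h3 h4; rewrite -/t.
    have t0 : 0 < t by rewrite /t; lra.
    have S a' c' : a <= a' <= a + t -> c <= c' <= c + t -> sub a' c' t.
      by move=> ha hc x y hxy; apply: hs; move: hxy; rewrite /in_square; lra.
    move=> /(_ (S _ _ _ _)) h1 /(_ (S _ _ _ _)) h2 /(_ (S _ _ _ _)) h3 /(_ (S _ _ _ _)) h4.
    have cls x y : in_square a c (t + t) x y -> closed_at p q x y.
      by rewrite -st => /hs; exact: cl.
    rewrite st (circulation_quarters _ _ _ _ _ t0 cls).
    have {}h1 := h1 ltac:(lra) ltac:(lra).
    have {}h2 := h2 ltac:(lra) ltac:(lra).
    have {}h3 := h3 ltac:(lra) ltac:(lra).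
    have {}h4 := h4 ltac:(lra) ltac:(lra).
    have -> : - (8 * e) * (t + t) ^+ 2 = - (8 * e) * t ^+ 2 + - (8 * e) * t ^+ 2 +
      (- (8 * e) * t ^+ 2 + - (8 * e) * t ^+ 2) by ring.
    by rewrite !lerD.
  have [d d0 hd] := circulation_near p q x y e e0 (cl _ _ hxy).
  exists d => // a c s hs ha hsub; apply: hd => // x' y' /hsub; exact: cl.
move=> /(_ (fun _ _ h => h)); rewrite -[leRHS]opprK -/k mulNr lerN2 /e.
have -> : 8 * (k / (16 * s0 ^+ 2)) * s0 ^+ 2 = k / 2.
  by field; rewrite gt_eqF.
lra.
Qed.
End Goursat.

(** * A maximum principle with a constant *)

Section WeakMaximum.
Context {R : realType}.
Implicit Types (G : R[i]^o -> R[i]^o) (z w : R[i]).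

(** Im G dx + Re G dy is the imaginary part of G dz; closedness is the
    Cauchy-Riemann equation. *)
Lemma derivable_closed_at G x y : derivable G (x +i* y)%C 1 ->
  closed_at (fun x y => Im (G (x +i* y)%C)) (fun x y => Re (G (x +i* y)%C)) x y.
Proof.
move=> /derivablecP[[dr di] hD]; exists di, dr, (- di) => e e0.
have [d d0 hd] := hD e e0; exists (d / 2) => [|x' y' hx hy]; first by lra.
have := hd ((x' - x) +i* (y' - y))%C.
have hn := normc_le_ReIm ((x' - x) +i* (y' - y))%C.
have -> : ((x +i* y)%C + ((x' - x) +i* (y' - y))%C : R[i]) = (x' +i* y')%C.
  by congr (_ +i* _)%C; rewrite /= addrC subrK.
have /[swap] /[apply] : nc ((x' - x) +i* (y' - y))%C < d.
  by apply: le_lt_trans hn _ => /=; lra.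
move: (G (x' +i* y')%C) (G (x +i* y)%C) => [u' v'] [u v] hg.
have {}hg := le_trans hg (ler_wpM2l (ltW e0) hn).
split.
  apply: le_trans (le_trans (normc_Im _) hg); rewrite /=.
  by rewrite le_eqVlt; apply/orP; left; apply/eqP; congr (`| _ |); ring.
apply: le_trans (le_trans (normc_Re _) hg); rewrite /=.
by rewrite le_eqVlt; apply/orP; left; apply/eqP; congr (`| _ |); ring.
Qed.

(** With w = s + it and F = a + w g one has g = F / w - a / w, where
    |w| >= s and Re (a / w) = a s / (s^2 + t^2) >= a / (2 s). *)
Lemma Re_quotient_le (a m s t : R) (g : R[i]) : 0 < s -> `|t| <= s -> 0 <= a ->
  nc (a%:C%C + (s +i* t)%C * g) <= m -> Re g <= m / s - a / (2 * s).
Proof.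
move=> s0 ts a0; set w := (s +i* t)%C; set F := _ + _ => hm.
have w2 : t ^+ 2 <= s ^+ 2 by rewrite -real_normK ?num_real// lerXn2r ?nnegrE ?normr_ge0// ltW.
have n0 : 0 < s ^+ 2 + t ^+ 2 by rewrite ltr_wpDr ?sqr_ge0// exprn_gt0.
have w0 : w != 0 by rewrite eq_complex /= gt_eqF.
have wn : s <= nc w by apply: le_trans (ler_norm _) (normc_Re w).
have -> : g = F * w^-1 - a%:C%C * w^-1.
  by rewrite -mulrBl /F addrAC subrr add0r mulrAC divff// mul1r.
rewrite (raddfB (@complex.Re R : {additive _ -> _})) lerD//.
  apply: le_trans (ler_norm _) (le_trans (normc_Re _) _).
  rewrite Normc.normcM Normc.normcV ler_pM ?normc_ge0 ?invr_ge0 ?normc_ge0//.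
  by rewrite lef_pV2// posrE// (lt_le_trans s0 wn).
rewrite lerN2 /= mul0r subr0 ler_pM// ?invr_ge0 ?ler_pdivlMr//; first by lra.
by rewrite ler_pdivrMl; nra.
Qed.

(** On each side of the square, [Re_quotient_le] bounds the integrand of the
    circulation of Im (G dz) by m / s - a / (2 s), after a rotation that takes
    the outward normal to 1.  The four sides have total length 8 s, so the
    circulation is at most 8 m - 4 a, whereas it is nonnegative by
    [goursat_square]. *)
Lemma weak_maximum_real G z0 (a m s : R) : 0 < s -> 0 <= a ->
  (forall z, `|Re (z - z0)| <= s -> `|Im (z - z0)| <= s -> derivable G z 1) ->
  (forall z, `|Re (z - z0)| <= s -> `|Im (z - z0)| <= s -> s <= nc (z - z0) ->
    nc (a%:C%C + (z - z0) * G z) <= m) ->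
  a <= 2 * m.
Proof.
move=> s0 a0 dG bG; case: z0 dG bG => x0 y0 dG bG.
pose p x y := Im (G (x +i* y)%C); pose q x y := Re (G (x +i* y)%C).
have cl x y : in_square (x0 - s) (y0 - s) (2 * s) x y -> closed_at p q x y.
  move=> hxy; apply: derivable_closed_at; apply: dG => /=;
    move: hxy; rewrite /in_square ler_norml; lra.
have := @goursat_square R p q (x0 - s) (y0 - s) (2 * s) _ cl.
have -> : 0 < 2 * s by lra.
move=> /(_ isT); set K := m / s - a / (2 * s).
have K2 : K * (2 * s) = 2 * m - a by rewrite /K; field; rewrite gt_eqF.
have hb x : x0 - s <= x <= x0 - s + 2 * s -> p x (y0 - s) <= K.
  move=> hx; rewrite /p; set g := G _.
  have -> : Im g = Re (- 'i%C * g) by case: (g) => u v /=; ring.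
  apply: (@Re_quotient_le a m s (x - x0)) => //; first by rewrite ler_norml; lra.
  have -> : (s +i* (x - x0))%C * (- 'i%C * g) = ((x +i* (y0 - s))%C - (x0 +i* y0)%C) * g.
    by rewrite mulrA; congr (_ * _); apply/eqP; rewrite eq_complex /=; apply/andP; split; apply/eqP; ring.
  apply: bG; [rewrite /= ler_norml; lra|rewrite /= ler_norml; lra|].
  apply: le_trans (normc_Im _); rewrite /= ler_normr; lra.
have ht x : x0 - s <= x <= x0 - s + 2 * s -> - K <= p x (y0 - s + 2 * s).
  move=> hx; rewrite /p lerNl; set g := G _.
  have -> : - Im g = Re ('i%C * g) by case: (g) => u v /=; ring.
  apply: (@Re_quotient_le a m s (x0 - x)) => //; first by rewrite ler_norml; lra.
  have -> : (s +i* (x0 - x))%C * ('i%C * g) = ((x +i* (y0 - s + 2 * s))%C - (x0 +i* y0)%C) * g.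
    by rewrite mulrA; congr (_ * _); apply/eqP; rewrite eq_complex /=; apply/andP; split; apply/eqP; ring.
  apply: bG; [rewrite /= ler_norml; lra|rewrite /= ler_norml; lra|].
  apply: le_trans (normc_Im _); rewrite /= ler_normr; lra.
have hr y : y0 - s <= y <= y0 - s + 2 * s -> q (x0 - s + 2 * s) y <= K.
  move=> hy; rewrite /q; set g := G _.
  apply: (@Re_quotient_le a m s (y - y0)) => //; first by rewrite ler_norml; lra.
  have -> : (s +i* (y - y0))%C * g = (((x0 - s + 2 * s) +i* y)%C - (x0 +i* y0)%C) * g.
    by congr (_ * _); apply/eqP; rewrite eq_complex /=; apply/andP; split; apply/eqP; ring.
  apply: bG; [rewrite /= ler_norml; lra|rewrite /= ler_norml; lra|].
  apply: le_trans (normc_Re _); rewrite /= ler_normr; lra.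
have hl y : y0 - s <= y <= y0 - s + 2 * s -> - K <= q (x0 - s) y.
  move=> hy; rewrite /q lerNl; set g := G _.
  have -> : - Re g = Re (- g) by case: (g).
  apply: (@Re_quotient_le a m s (y0 - y)) => //; first by rewrite ler_norml; lra.
  have -> : (s +i* (y0 - y))%C * (- g) = (((x0 - s) +i* y)%C - (x0 +i* y0)%C) * g.
    by rewrite mulrN -mulNr; congr (_ * _); apply/eqP; rewrite eq_complex /=; apply/andP; split; apply/eqP; ring.
  apply: bG; [rewrite /= ler_norml; lra|rewrite /= ler_norml; lra|].
  apply: le_trans (normc_Re _); rewrite /= ler_normr; lra.
have cp y (hy : y0 - s <= y <= y0 - s + 2 * s) := closed_at_withinl _ _ _ _ _ _ hy cl.
have cq x (hx : x0 - s <= x <= x0 - s + 2 * s) := closed_at_withinr _ _ _ _ _ _ hx cl.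
have I1 : (- (2 * K)) * (x0 - s + 2 * s - (x0 - s)) <=
    \int[lebesgue_measure]_(x in `[x0 - s, x0 - s + 2 * s]) (p x (y0 - s + 2 * s) - p x (y0 - s)).
  apply: int_ge => [|x|x hx]; first by lra.
    by apply: cvgB; [apply: (cp (y0 - s + 2 * s))|apply: (cp (y0 - s))]; lra.
  have := hb _ hx; have := ht _ hx; lra.
have I2 : (- (2 * K)) * (y0 - s + 2 * s - (y0 - s)) <=
    \int[lebesgue_measure]_(y in `[y0 - s, y0 - s + 2 * s]) (q (x0 - s) y - q (x0 - s + 2 * s) y).
  apply: int_ge => [|y|y hy]; first by lra.
    by apply: cvgB; [apply: (cq (x0 - s))|apply: (cq (x0 - s + 2 * s))]; lra.
  have := hl _ hy; have := hr _ hy; lra.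
rewrite intB in I1; [|by apply: cp; lra|by apply: cp; lra].
rewrite intB in I2; [|by apply: cq; lra|by apply: cq; lra].
rewrite /circulation => I0; lra.
Qed.

(** Multiplication by a complex number of modulus 1 makes A a nonnegative
    real. *)
Lemma weak_maximum G z0 (A : R[i]) (m s : R) : 0 < s ->
  (forall z, `|Re (z - z0)| <= s -> `|Im (z - z0)| <= s -> derivable G z 1) ->
  (forall z, `|Re (z - z0)| <= s -> `|Im (z - z0)| <= s -> s <= nc (z - z0) ->
    nc (A + (z - z0) * G z) <= m) ->
  nc A <= 2 * m.
Proof.
move=> s0 dG bG.
have [u u1 uA] : exists2 u : R[i], nc u = 1 & u * A = (nc A)%:C%C.
  have [->|A0] := eqVneq A 0; first by exists 1; rewrite ?Normc.normc1// mulr0 Normc.normc0.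
  exists ((nc A)%:C%C / A); last by rewrite divfK.
  by rewrite Normc.normcM Normc.normcV normcR ger0_norm ?normc_ge0// divff// gt_eqF ?normc_gt0.
refine (weak_maximum_real (fun z => u * G z) z0 (nc A) m s s0 (normc_ge0 A) _ _).
  move=> z h1 h2; have /derivablecP[D hD] := dG z h1 h2.
  apply/derivablecP; exists (u * D) => e /hD[d d0 hd]; exists d => // h /hd.
  by rewrite -mulrA -!mulrBr Normc.normcM u1 mul1r.
move=> z h1 h2 h3; rewrite mulrCA -uA -mulrDr Normc.normcM u1 mul1r; exact: bG.
Qed.

End WeakMaximum.

(** * Series dominated by a geometric series *)

Section RealSums.
Context {R : realType}.
Implicit Types (u v : nat -> R) (K : R).

(** The dominating sum telescopes, as K / 2^(k+1) is K / 2^k - K / 2^(k+1). *)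
Lemma partial_tail v K m n : 0 <= K -> (m <= n)%N ->
  (forall k, (m <= k)%N -> `|v k| <= K / 2 ^+ k.+1) ->
  \sum_(m <= k < n) `|v k| <= K.
Proof.
move=> K0 mn hv.
have : \sum_(m <= k < n) `|v k| <= K / 2 ^+ m - K / 2 ^+ n.
  elim: n mn => [|n IH].
    by rewrite leqn0 => /eqP ->; rewrite big_geq// subrr.
  rewrite leq_eqVlt => /predU1P[->|mn]; first by rewrite big_geq// subrr.
  rewrite big_nat_recr//=; apply: le_trans (lerD (IH mn) (hv n mn)) _.
  have -> : K / 2 ^+ n = K / 2 ^+ n.+1 + K / 2 ^+ n.+1.
    by rewrite exprS; field; rewrite expf_neq0.
  lra.
move=> /le_trans; apply.
have h0 : 0 <= K / 2 ^+ n by rewrite divr_ge0// exprn_ge0.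
have h1 : K / 2 ^+ m <= K by rewrite ler_pdivrMr ?exprn_gt0// ler_peMr// exprn_ege1// ler1n.
lra.
Qed.

Lemma geom_cvg v K : 0 <= K -> (forall k, `|v k| <= K / 2 ^+ k.+1) ->
  cvgn (series v).
Proof.
move=> K0 hv; apply: normed_cvg; apply: nondecreasing_is_cvgn.
  by apply/nondecreasing_seqP => n; rewrite -[leRHS]/(series _ n.+1) -[leLHS]/(series _ n) seriesSr lerDl normr_ge0.
by exists K => _ [n _ <-]; apply: partial_tail.
Qed.

Lemma geom_tail v K m : 0 <= K -> cvgn (series v) ->
  (forall k, (m <= k)%N -> `|v k| <= K / 2 ^+ k.+1) ->
  `|limn (series v) - series v m| <= K.
Proof.
move=> K0 cv hv.
have c : (fun n => `|series v n - series v m|) @ \oo --> `|limn (series v) - series v m|.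
  by apply: cvg_norm; apply: cvgB => //; exact: cvg_cst.
rewrite -(cvg_lim _ c)//; apply: limr_le; first by apply/cvg_ex; eexists; exact: c.
exists m => // n /= mn; rewrite sub_series_geq//.
exact: le_trans (ler_norm_sum _ _ _) (partial_tail _ _ _ _ K0 mn hv).
Qed.

End RealSums.

Section ComplexSums.
Context {R : realType}.
Implicit Types (u v : nat -> R[i]) (K : R).

(** The sum is taken in the real and imaginary parts, where completeness of
    the reals gives convergence. *)
Definition csum u : R[i] :=
  (limn (series (fun k => Re (u k))) +i* limn (series (fun k => Im (u k))))%C.

Definition geom_bounded K u := 0 <= K /\ forall k, nc (u k) <= K / 2 ^+ k.+1.

Lemma geom_re K u : geom_bounded K u -> cvgn (series (fun k => Re (u k))).
Proof. by case=> K0 h; apply: (geom_cvg _ K) => // k; apply: le_trans (normc_Re _) (h k). Qed.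

Lemma geom_im K u : geom_bounded K u -> cvgn (series (fun k => Im (u k))).
Proof. by case=> K0 h; apply: (geom_cvg _ K) => // k; apply: le_trans (normc_Im _) (h k). Qed.

(** The factor 2 comes from adding the bounds for the real and the imaginary
    part. *)
Lemma csum_tail K K' u m : geom_bounded K u -> 0 <= K' ->
  (forall k, (m <= k)%N -> nc (u k) <= K' / 2 ^+ k.+1) ->
  nc (csum u - \sum_(k < m) u k) <= 2 * K'.
Proof.
move=> gu K'0 hu; apply: le_trans (normc_le_ReIm _) _.
have -> : 2 * K' = K' + K' by ring.
have ReB (x y : R[i]) : Re (x - y) = Re x - Re y by case: x; case: y.
have ImB (x y : R[i]) : Im (x - y) = Im x - Im y by case: x; case: y.
have eR : Re (\sum_(k < m) u k) = series (fun k => Re (u k)) m.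
  rewrite /series /= big_mkord.
  by apply: (big_morph (@complex.Re R)) => // -[x y] [].
have eI : Im (\sum_(k < m) u k) = series (fun k => Im (u k)) m.
  rewrite /series /= big_mkord.
  by apply: (big_morph (@complex.Im R)) => // -[x y] [].
rewrite ReB ImB eR eI /= lerD//.
  apply: geom_tail => //; first exact: geom_re gu.
  by move=> k mk; apply: le_trans (normc_Re _) (hu k mk).
apply: geom_tail => //; first exact: geom_im gu.
by move=> k mk; apply: le_trans (normc_Im _) (hu k mk).
Qed.

Lemma csum_le K u : geom_bounded K u -> nc (csum u) <= 2 * K.
Proof.
move=> gu; have [K0 hu] := gu; have := csum_tail K K u 0 gu K0 (fun k _ => hu k).
by rewrite big_ord0 subr0.
Qed.

Lemma lim_lin (a b : R) (u v w : nat -> R) :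
  cvgn (series u) -> cvgn (series v) -> cvgn (series w) ->
  limn (series (fun k => a * u k + b * v k + w k)) =
  a * limn (series u) + b * limn (series v) + limn (series w).
Proof.
move=> cu cv cw; apply/cvg_lim => //.
have -> : series (fun k => a * u k + b * v k + w k) =
    (fun n => a * series u n + b * series v n + series w n).
  by apply/funext => n; rewrite /series /= !big_split/= !mulr_sumr.
by apply: cvgD => //; apply: cvgD; apply: cvgMr.
Qed.

Lemma csum_lin (a : R[i]) K K' u v : geom_bounded K u -> geom_bounded K' v ->
  csum (fun k => a * u k + v k) = a * csum u + csum v.
Proof.
move=> gu gv; have ru := geom_re _ _ gu; have iu := geom_im _ _ gu.
have rv := geom_re _ _ gv; have iv := geom_im _ _ gv.
case: a => ar ai; rewrite /csum.
have -> : (fun k => Re ((ar +i* ai)%C * u k + v k)) =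
    (fun k => ar * Re (u k) + (- ai) * Im (u k) + Re (v k)).
  by apply/funext => k; case: (u k) => x y; case: (v k) => x' y' /=; ring.
have -> : (fun k => Im ((ar +i* ai)%C * u k + v k)) =
    (fun k => ar * Im (u k) + ai * Re (u k) + Im (v k)).
  by apply/funext => k; case: (u k) => x y; case: (v k) => x' y' /=; ring.
by rewrite !lim_lin//; apply/eqP; rewrite eq_complex /=; apply/andP; split; apply/eqP; ring.
Qed.

Lemma geomM K c u v : geom_bounded K u -> 0 <= c -> (forall k, nc (v k) <= c) ->
  geom_bounded (K * c) (fun k => u k * v k).
Proof.
move=> [K0 hu] c0 hv; split; first by rewrite mulr_ge0.
by move=> k; rewrite Normc.normcM mulrAC ler_pM ?normc_ge0.
Qed.

Lemma geomD K K' u v : geom_bounded K u -> geom_bounded K' v -> geom_bounded (K + K') (fun k => u k + v k).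
Proof.
move=> [K0 hu] [K'0 hv]; split; first by rewrite addr_ge0.
by move=> k; apply: le_trans (le_normcD _ _) _; rewrite mulrDl lerD.
Qed.

Lemma geomZ K (a : R[i]) u : geom_bounded K u -> geom_bounded (nc a * K) (fun k => a * u k).
Proof.
move=> [K0 hu]; split; first by rewrite mulr_ge0// normc_ge0.
by move=> k; rewrite Normc.normcM -mulrA ler_wpM2l ?normc_ge0.
Qed.

End ComplexSums.

(** * Series of simple poles *)

Section CauchyKernel.
Context {R : realType}.
Implicit Types (e w : nat -> R[i]) (K d r : R).

Definition simple_poles e w (z : R[i]) : R[i] := csum (fun k => e k / (w k - z)).

Lemma normcV_le (x : R[i]) d : 0 < d -> d <= nc x -> nc x^-1 <= d^-1.
Proof. by move=> d0 dx; rewrite Normc.normcV lef_pV2 ?posrE// (lt_le_trans d0). Qed.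

(** The series may be differentiated termwise, because
    1 / (w - z - h) - 1 / (w - z) - h / (w - z)^2 equals
    h^2 / ((w - z)^2 (w - z - h)), so that the remainder is h^2 times a series
    bounded uniformly in h. *)
Lemma simple_poles_derivable e w (z : R[i]) K d r : 0 < d -> 0 < r -> geom_bounded K e ->
  (forall k y, nc (y - z) < r -> d <= nc (w k - y)) ->
  derivable (simple_poles e w : R[i]^o -> R[i]^o) z 1.
Proof.
move=> d0 r0 ge hd; have K0 : 0 <= K := ge.1.
pose i y k := (w k - y)^-1.
have iz0 y k : nc (y - z) < r -> w k - y != 0.
  by move=> /(hd k) h; rewrite -normc_gt0 (lt_le_trans d0).
have hi y k : nc (y - z) < r -> nc (i y k) <= d^-1.
  by move=> yr; apply: normcV_le => //; exact: hd.
have hz : nc (z - z) < r by rewrite subrr Normc.normc0.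
have dV : 0 <= d^-1 by rewrite invr_ge0 ltW.
have g1 y : nc (y - z) < r -> geom_bounded (K * d^-1) (fun k => e k * i y k).
  by move=> yr; apply: geomM => // k; exact: hi.
have g2 : geom_bounded (K * d^-1 * d^-1) (fun k => e k * i z k * i z k).
  by apply: geomM => // [|k]; [exact: g1|exact: hi].
pose M := 2 * (K * d^-1 * d^-1 * d^-1) + 1.
have M0 : 0 < M.
  by rewrite ltr_wpDl// mulr_ge0// !mulr_ge0.
apply/derivablecP; exists (csum (fun k => e k * i z k * i z k)) => eps eps0.
exists (Num.min r (eps / M)); first by rewrite lt_min r0 divr_gt0.
move=> h; rewrite lt_min => /andP[hr hM].
have yr : nc (z + h - z) < r by rewrite addrC addKr.
have g3 : geom_bounded (K * d^-1 * d^-1 * d^-1) (fun k => e k * i z k * i z k * i (z + h) k).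
  by apply: geomM => // k; exact: hi.
have -> : simple_poles e w (z + h) - simple_poles e w z -
    csum (fun k => e k * i z k * i z k) * h =
    h ^+ 2 * csum (fun k => e k * i z k * i z k * i (z + h) k).
  rewrite /simple_poles -/(i (z + h)).
  have -> : csum (fun k => e k / (w k - (z + h))) =
      h ^+ 2 * csum (fun k => e k * i z k * i z k * i (z + h) k) +
      (h * csum (fun k => e k * i z k * i z k) + csum (fun k => e k * i z k)).
    have gz := geomD _ _ _ _ (geomZ _ h _ g2) (g1 z hz).
    rewrite -(csum_lin h _ _ _ _ g2 (g1 z hz)) -(csum_lin (h ^+ 2) _ _ _ _ g3 gz).
    congr csum; apply/funext => k; rewrite /i.
    by field; rewrite (iz0 _ _ hz) opprD addrA /= -addrA -opprD (iz0 _ _ yr).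
  by ring.
rewrite Normc.normcM normcX expr2 -mulrA mulrCA [eps * _]mulrC.
rewrite ler_wpM2l ?normc_ge0//.
have h1 := csum_le _ _ g3; apply: le_trans (ler_wpM2l (normc_ge0 h) h1) _.
apply: le_trans (_ : nc h * M <= _); first by rewrite ler_wpM2l ?normc_ge0// lerDl.
by rewrite -ler_pdivlMr// ltW.
Qed.

Lemma derivable_local (f g : R[i]^o -> R[i]^o) (z : R[i]) r : 0 < r ->
  (forall y : R[i], nc (y - z) < r -> f y = g y) ->
  derivable f z 1 -> derivable g z 1.
Proof.
move=> r0 fg /derivablecP[D hD]; apply/derivablecP; exists D => eps /hD[d d0 hd].
exists (Num.min d r) => [|h]; first by rewrite lt_min d0.
rewrite lt_min => /andP[hdd hr]; rewrite -!fg ?subrr ?Normc.normc0//; last by rewrite addrC addKr.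
exact: hd.
Qed.

Lemma derivable_quotient (F : R[i]^o -> R[i]^o) (A z0 z : R[i]) : z != z0 ->
  derivable F z 1 -> derivable (fun y : R[i]^o => (F y - A) / (y - z0) : R[i]^o) z 1.
Proof.
move=> zz0 dF.
have d1 := @derivableB R[i] R[i]^o R[i]^o F (cst (A : R[i]^o)) z 1 dF (@derivable_cst R[i] R[i]^o R[i]^o A z 1).
have d2 := @derivableB R[i] R[i]^o R[i]^o id (cst (z0 : R[i]^o)) z 1 (@derivable_id R[i] R[i]^o z 1) (@derivable_cst R[i] R[i]^o R[i]^o z0 z 1).
have d3 := @derivableV R[i] R[i]^o _ z 1 _ d2.
have nz : (id - cst z0 : R[i]^o -> R[i]^o) z != 0 by rewrite subr_eq0.
have d4 := @derivableM R[i] R[i]^o _ _ z 1 d1 (d3 nz).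
exact: d4.
Qed.

End CauchyKernel.

(** * The Cauchy estimate for an extension *)

Section TaylorBound.
Context {R : realType}.
Implicit Types (e w : nat -> R[i]) (K d r s m : R).

Lemma simple_poles_geom e w (z : R[i]) K d : 0 < d -> geom_bounded K e ->
  (forall k, d <= nc (w k - z)) -> geom_bounded (K * d^-1) (fun k => e k / (w k - z)).
Proof.
move=> d0 ge hd; apply: geomM => // [|k]; first by rewrite invr_ge0 ltW.
exact: normcV_le.
Qed.

(** Dividing by z - z0 the difference of the values at z and z0 leads again to
    a series of simple poles with the same w; this makes induction on the order
    of the Taylor coefficient possible. *)
Lemma simple_poles_difference e w (z z0 : R[i]) K d : 0 < d -> geom_bounded K e ->
  (forall k, d <= nc (w k - z0)) -> (forall k, d <= nc (w k - z)) ->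
  simple_poles e w z - simple_poles e w z0 =
  (z - z0) * simple_poles (fun k => e k / (w k - z0)) w z.
Proof.
move=> d0 ge hz0 hz; have n0 y k : d <= nc (w k - y) -> w k - y != 0.
  by move=> h; rewrite -normc_gt0 (lt_le_trans d0).
have g0 := simple_poles_geom _ _ _ _ _ d0 ge hz0.
have g1 := simple_poles_geom _ _ _ _ _ d0 g0 hz.
rewrite [simple_poles e w z](_ : _ = csum (fun k =>
   (z - z0) * (e k / (w k - z0) / (w k - z)) + e k / (w k - z0))).
  by rewrite (csum_lin _ _ _ _ _ g1 g0) addrK.
congr csum; apply/funext => k; field.
by rewrite !n0.
Qed.

Variables (w : nat -> R[i]) (z0 : R[i]) (d r s : R).
Hypotheses (d0 : 0 < d) (r0 : 0 < r) (s0 : 0 < s).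
Hypothesis poles_far : forall k y, nc (y - z0) < r -> d <= nc (w k - y).

(** F is defined on the square of half-side s around z0, is given by a series
    of simple poles near z0, and is bounded by m on the part of the square
    outside the disc of radius s, in particular on the boundary. *)
Definition continues (F : R[i]^o -> R[i]^o) (e : nat -> R[i]) m :=
  [/\ forall z : R[i], nc (z - z0) < r -> F z = simple_poles e w z,
      forall z : R[i], `|Re (z - z0)| <= s -> `|Im (z - z0)| <= s ->
        derivable F z 1 &
      forall z : R[i], `|Re (z - z0)| <= s -> `|Im (z - z0)| <= s ->
        s <= nc (z - z0) -> nc (F z) <= m].

(** The divided difference of F at z0 is complex differentiable on the square:
    away from z0 as a quotient, and at z0 because it is a series of simple poles
    there.  So [weak_maximum] applies to F = F(z0) + (z - z0) G and gives
    |F(z0)| <= 2 m, whence |G| <= (m + 2 m) / s on the boundary. *)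
Lemma continues_step F e K m : geom_bounded K e -> continues F e m ->
  nc (csum (fun k => e k / (w k - z0))) <= 2 * m /\
  exists G, continues G (fun k => e k / (w k - z0)) (m * (3 / s)).
Proof.
move=> ge [Ff dF bF]; have z0r : nc (z0 - z0) < r by rewrite subrr Normc.normc0.
set e' := fun k => _.
have ge' : geom_bounded (K * d^-1) e'.
  by apply: simple_poles_geom => // k; exact: poles_far.
pose G (z : R[i]) := if nc (z - z0) < r then simple_poles e' w z
                     else (F z - F z0) / (z - z0).
have GE (z : R[i]) : z != z0 -> G z = (F z - F z0) / (z - z0).
  rewrite /G => zz0; case: ifPn => // zr; rewrite !Ff//.
  rewrite (simple_poles_difference _ _ _ _ K d)// => [|k|k]; try exact: poles_far.
  by rewrite mulrAC divff ?mul1r// subr_eq0.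
have dG (z : R[i]) : `|Re (z - z0)| <= s -> `|Im (z - z0)| <= s ->
    derivable (G : R[i]^o -> R[i]^o) z 1.
  move=> h1 h2; have [->|zz0] := eqVneq z z0.
    apply: (derivable_local (simple_poles e' w) _ _ r) => //.
      by move=> y yr; rewrite /G yr.
    exact: (simple_poles_derivable _ _ _ (K * d^-1) d r).
  apply: (derivable_local (fun y => (F y - F z0) / (y - z0)) _ _ (nc (z - z0))).
  - by rewrite normc_gt0 subr_eq0.
  - move=> y yz; rewrite GE//; apply: contraTneq yz => ->.
    by rewrite normcB ltxx.
  - by apply: derivable_quotient => //; exact: dF.
have A2 : nc (F z0) <= 2 * m.
  apply: (weak_maximum G z0 _ m s) => // z h1 h2 h3.
  rewrite GE; last by rewrite -subr_eq0 -normc_gt0 (lt_le_trans s0).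
  rewrite (mulrC (z - z0)) divfK; last by rewrite -normc_gt0 (lt_le_trans s0).
  by rewrite addrC subrK; exact: bF.
split; first by rewrite -[csum _]/(simple_poles e w z0) -Ff.
exists G; split => //.
  by move=> z zr; rewrite /G zr.
move=> z h1 h2 h3; rewrite GE; last by rewrite -subr_eq0 -normc_gt0 (lt_le_trans s0).
have m1 := bF z h1 h2 h3.
rewrite Normc.normcM Normc.normcV mulrA ler_pM ?invr_ge0 ?normc_ge0//.
  apply: le_trans (le_normcD _ _) _; rewrite normcN; lra.
by rewrite lef_pV2 ?posrE// (lt_le_trans s0 h3).
Qed.

Lemma taylor_coefficient_le n F e K m : geom_bounded K e -> continues F e m ->
  nc (csum (fun k => e k / (w k - z0) ^+ n.+1)) <= 2 * m * (3 / s) ^+ n.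
Proof.
elim: n F e K m => [|n IH] F e K m ge cF; have [A [G cG]] := continues_step F e K m ge cF.
  by rewrite expr0 mulr1.
have -> : (fun k => e k / (w k - z0) ^+ n.+2) =
    (fun k => e k / (w k - z0) / (w k - z0) ^+ n.+1).
  by apply/funext => k; rewrite exprS invfM mulrA.
have -> : 2 * m * (3 / s) ^+ n.+1 = 2 * (m * (3 / s)) * (3 / s) ^+ n.
  by rewrite exprS; ring.
apply: (IH G _ (K * d^-1)) => //; apply: simple_poles_geom => // k.
by apply: poles_far; rewrite subrr Normc.normc0.
Qed.

End TaylorBound.

(** * Gliding hump *)

Section GlidingHump.
Context {R : realType}.

(** Think of A m n k as the value of the n-th functional of the m-th test on
    the k-th summand, and of T m n as the bound to be exceeded by the sum for
    some n.  At step m the terms before m are fixed.  For a suitable n the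
    summand A m n m, with the largest coefficient x still permitted, exceeds
    2 T m n, so that with c_m = 0 or with c_m = x the partial sum exceeds T m n.
    The later coefficients are then restricted to a tolerance small enough to
    keep this strict inequality. *)
Lemma gliding_hump (A : nat -> nat -> nat -> R[i]) (T D : nat -> nat -> R) (b : nat -> R) :
  (forall k, 0 < b k) -> (forall m n, 0 <= T m n) ->
  (forall m n k, nc (A m n k) <= D m n) ->
  (forall m x, 0 < x -> exists n, T m n < x * nc (A m n m)) ->
  exists c : nat -> R, (forall k, 0 <= c k <= b k / 2 ^+ k.+1) /\
    forall m, exists n, T m n < nc (csum (fun k => (c k)%:C%C * A m n k)).
Proof.
move=> b0 T0 AD hA.
have D0 m n : 0 <= D m n := le_trans (normc_ge0 _) (AD m n 0%N).
(* A state consists of the coefficients chosen so far and the tolerance t left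
   for the later ones: c_k <= t / 2^(k+1). *)
pose S := ((nat -> R) * R)%type.
pose good m (s s' : S) := [/\ 0 < s'.2 <= s.2, forall k, k != m -> s'.1 k = s.1 k,
  0 <= s'.1 m <= Num.min (b m) s.2 / 2 ^+ m.+1 &
  exists n, T m n + 2 * (s'.2 * D m n) <
    nc (\sum_(k < m.+1) (s'.1 k)%:C%C * A m n k)].
have step (ms : nat * S) : exists s', 0 < ms.2.2 -> good ms.1 ms.2 s'.
  case: ms => m [c t] /=; have [t0|nt] := pselect (0 < t); last by exists (c, t).
  pose x := Num.min (b m) t / 2 ^+ m.+1.
  have x0 : 0 < x by rewrite divr_gt0 ?exprn_gt0// lt_min b0.
  have [n hn] := hA m (x / 2) (divr_gt0 x0 (ltr0Sn _ _)).
  pose upd (y : R) k := if k == m then y else c k.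
  have sumE y : \sum_(k < m.+1) (upd y k)%:C%C * A m n k =
      \sum_(k < m) (c k)%:C%C * A m n k + y%:C%C * A m n m.
    rewrite big_ord_recr /= /upd eqxx; congr (_ + _).
    by apply: eq_bigr => k _; rewrite ltn_eqF.
  have [y hy hyT] : exists2 y, 0 <= y <= x &
      T m n < nc (\sum_(k < m.+1) (upd y k)%:C%C * A m n k).
    set s := \sum_(k < m) (c k)%:C%C * A m n k in sumE.
    have [hs|hs] := ltP (T m n) (nc s).
      exists 0; first by rewrite lexx ltW.
      by rewrite sumE mul0r addr0.
    exists x; first by rewrite lexx ltW.
    rewrite sumE addrC -[s]opprK; apply: lt_le_trans (normc_leB _ _).
    rewrite normcN Normc.normcM normcR gtr0_norm//; lra.
  pose g := nc (\sum_(k < m.+1) (upd y k)%:C%C * A m n k) - T m n.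
  have {hyT} g0 : 0 < g by rewrite subr_gt0.
  have D1 : 0 < D m n + 1 by rewrite ltr_wpDl.
  pose t' := g / (2 * (D m n + 1)).
  have t'0 : 0 < t' by rewrite divr_gt0// mulr_gt0.
  exists (upd y, Num.min t t') => _; split => /=.
  - by rewrite lt_min t0 t'0 ge_min lexx.
  - by move=> k /negbTE km; rewrite /upd km.
  - by rewrite /upd eqxx.
  exists n; rewrite -ltrBrDl -/g.
  apply: le_lt_trans (_ : 2 * (t' * D m n) < g).
    by rewrite ler_wpM2l// ler_wpM2r// ge_min lexx orbT.
  have -> : 2 * (t' * D m n) = g * (D m n / (D m n + 1)).
    by rewrite /t'; field; rewrite gt_eqF.
  by rewrite gtr_pMr// ltr_pdivrMr// mul1r ltrDl.
have [st hst] := choice step.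
pose fix u n : S := if n is m.+1 then st (m, u m) else (fun=> 0, 1).
have ut n : 0 < (u n).2.
  by elim: n => [|n IH] /=; [exact: ltr01|have [/andP[]] := hst (n, u n) IH].
have gd n : good n (u n) (u n.+1) := hst (n, u n) (ut n).
have ud m n : (m <= n)%N -> (u n).2 <= (u m).2.
  elim: n => [|n IH]; first by rewrite leqn0 => /eqP ->.
  rewrite leq_eqVlt => /predU1P[->//|/IH]; apply: le_trans.
  by have [/andP[]] := gd n.
pose c k := (u k.+1).1 k.
have uc n k : (k < n)%N -> (u n).1 k = c k.
  elim: n => [//|n IH]; rewrite ltnS leq_eqVlt => /predU1P[->//|kn].
  by have [_ h _ _] := gd n; rewrite h ?IH// ltn_eqF.
have cb k : 0 <= c k <= b k / 2 ^+ k.+1.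
  have [_ _ /andP[-> h] _] := gd k; apply: le_trans h _.
  by rewrite ler_pM2r ?invr_gt0 ?exprn_gt0// ge_min lexx.
have ct m k : (m <= k)%N -> c k <= (u m).2 / 2 ^+ k.+1.
  move=> mk; have [_ _ /andP[_ h] _] := gd k; apply: le_trans h _.
  by rewrite ler_pM2r ?invr_gt0 ?exprn_gt0// ge_min ud ?orbT.
exists c; split => // m; have [_ _ _ [n hn]] := gd m; exists n.
move: hn; under eq_bigr => k _ do rewrite uc ?ltn_ord//.
set s := \sum_(k < m.+1) _ => hn; set t := csum _.
have ctA k K : c k <= K -> nc ((c k)%:C%C * A m n k) <= K * D m n.
  have /andP[c0 _] := cb k.
  by move=> cK; rewrite Normc.normcM normcR ger0_norm// ler_pM ?normc_ge0.
have gc : geom_bounded ((u 0%N).2 * D m n) (fun k => (c k)%:C%C * A m n k).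
  split=> [|k]; first by rewrite mulr_ge0// ltW.
  by rewrite mulrAC; apply: ctA; exact: ct.
have := csum_tail _ ((u m.+1).2 * D m n) _ m.+1 gc; rewrite -/t -/s.
have -> : 0 <= (u m.+1).2 * D m n by rewrite mulr_ge0// ltW.
move=> /(_ isT) ht; have {}ht : nc (t - s) <= 2 * ((u m.+1).2 * D m n).
  by apply: ht => k mk; rewrite mulrAC; apply: ctA; exact: ct.
have := normc_leB s (s - t); rewrite subKr (normcB s) => h.
apply: lt_le_trans _ h; lra.
Qed.

End GlidingHump.

(** * Discs, components and boundary points *)

Section Topology.
Context {R : realType}.
Implicit Types (z : R[i]) (A U W Omega : set R[i]^o).

Lemma disc_connected z (r : R) : 0 < r -> connected ([set y | nc (y - z) < r] : set R[i]^o).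
Proof.
move=> r0; pose seg (y : R[i]) (t : R^o) : R[i]^o := z + t%:C%C * (y - z).
have -> : [set y | nc (y - z) < r] =
    \bigcup_(y in [set y : R[i]^o | nc (y - z) < r]) (seg y @` `[0, 1]).
  apply/seteqP; split => y /=.
    move=> yr; exists y => //; exists 1; first by rewrite /= in_itv /= ler01 lexx.
    by rewrite /seg mul1r addrC subrK.
  move=> [x /= xr [t /=]]; rewrite in_itv /= => /andP[t0 t1] <-.
  rewrite /seg addrAC subrr add0r Normc.normcM normcR ger0_norm//.
  by apply: le_lt_trans xr; rewrite ler_piMl ?normc_ge0.
apply: bigcup_connected.
  exists z => y /= _; exists 0; first by rewrite /= in_itv /= lexx ler01.
  by rewrite /seg mul0r addr0.
move=> y /= yr; apply: connected_continuous_connected; first exact: segment_connected.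
apply: continuous_subspaceT => t B /nbhs_normc[e e0 hB].
pose k := nc (y - z) + 1; have k0 : 0 < k by rewrite ltr_wpDl// normc_ge0.
apply/nbhs_normP; exists (e / k); first by rewrite /= divr_gt0.
move=> x; rewrite /ball_ /= => tx; apply: hB.
rewrite /seg opprD addrACA subrr add0r -mulrBl -(raddfB (real_complex R)) Normc.normcM normcR distrC.
apply: le_lt_trans (_ : `|t - x| * k < _); first by rewrite ler_wpM2l// lerDl.
by rewrite -ltr_pdivlMr.
Qed.

Lemma component_disc A x y (r : R) : 0 < r -> connected_component A x y ->
  (forall t : R[i], nc (t - y) < r -> A t) ->
  forall t : R[i], nc (t - y) < r -> connected_component A x t.
Proof.
move=> r0 Wy rA t tr; rewrite (same_connected_component Wy).
apply: (connected_component_max (B := [set t | nc (t - y) < r])) => //=.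
- by rewrite subrr Normc.normc0.
- exact: disc_connected.
Qed.

Lemma closure_normc A z : closure A z <->
  forall r : R, 0 < r -> exists2 y : R[i], A y & nc (y - z) < r.
Proof.
split=> [cA r r0|h B /nbhs_normc[r r0 hB]].
  have /cA[y [Ay yr]] : nbhs (z : R[i]^o) [set y | nc (y - z) < r].
    by apply/nbhs_normc; exists r.
  by exists y.
by have [y Ay yr] := h r r0; exists y; split => //; exact: hB.
Qed.

(** Otherwise the component would be closed in U, hence equal to U, as it is
    also open; but U is not contained in Omega. *)
Lemma component_boundary U Omega x : open U -> connected U -> open Omega ->
  (U `&` Omega) x -> U `&` ~` Omega !=set0 ->
  exists zeta : R[i], [/\ U zeta, ~ Omega zeta &
    closure (connected_component (U `&` Omega) x) zeta].
Proof.
move=> oU cU oO UOx [y [Uy nOy]]; set W := connected_component _ x.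
apply: contrapT => nex; apply: nOy.
have WUO : W `<=` U `&` Omega by apply: connected_component_sub.
have oUO : open (U `&` Omega) by apply: openI.
have oW : open W.
  rewrite openE => z Wz; rewrite /interior.
  have [r r0 hr] := openc _ _ oUO (WUO _ Wz).
  by apply/nbhs_normc; exists r => // t; apply: component_disc hr t.
suff WU : W = U by have [] : (U `&` Omega) y by apply: WUO; rewrite WU.
apply: cU.
- by exists x; exact: connected_component_refl.
- by exists W => //; apply/esym/setIidr => z /WUO[].
- exists (closure W); first exact: closed_closure.
  apply/seteqP; split => [z Wz|z [Uz cWz]].
    by split; [have [] := WUO _ Wz|exact: subset_closure].
  have Oz : Omega z by apply: contrapT => nOz; apply: nex; exists z.
  have [r r0 hr] := openc _ _ oUO (conj Uz Oz).
  have [t Wt tr] := (closure_normc W z).1 cWz r r0.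
  have Wtz : connected_component (U `&` Omega) t z.
    apply: (connected_component_max (B := [set t | nc (t - z) < r]));
      [exact: tr|exact: hr|exact: disc_connected|].
    by rewrite /= subrr Normc.normc0.
  by rewrite /W (same_connected_component Wt).
Qed.

Lemma rational_point A z : open A -> A z -> forall r : R, 0 < r ->
  exists p q : rat, A (ratr p +i* ratr q)%C /\ nc ((ratr p +i* ratr q)%C - z) < r.
Proof.
move=> oA Az r r0; have [e e0 he] := openc _ _ oA Az.
case: z Az he => a b Az he; pose m := Num.min e r.
have m0 : 0 < m by rewrite lt_min e0.
have [p hp] := rat_in_itvoo (x := a) (y := a + m / 2) ltac:(lra).
have [q hq] := rat_in_itvoo (x := b) (y := b + m / 2) ltac:(lra).
have h : nc ((ratr p +i* ratr q)%C - (a +i* b)%C) < m.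
  apply: le_lt_trans (normc_le_ReIm _) _ => /=.
  move: hp hq; rewrite !in_itv /= => hp hq; rewrite !ger0_norm; lra.
exists p, q; split; last by apply: lt_le_trans h _; rewrite ge_min lexx orbT.
by apply: he; apply: lt_le_trans h _; rewrite ge_min lexx.
Qed.

Lemma derivable_bounded (F : R[i]^o -> R[i]^o) z : derivable F z 1 ->
  exists2 r : R, 0 < r & forall y : R[i], nc (y - z) < r -> nc (F y) <= nc (F z) + 1.
Proof.
move=> /derivablecP[D /(_ 1 ltr01)[d d0 hd]].
pose k := nc D + 1; have k0 : 0 < k by rewrite ltr_wpDl// normc_ge0.
exists (Num.min d (k^-1)); first by rewrite lt_min d0 invr_gt0.
move=> y; rewrite lt_min => /andP[yd yk].
have := hd _ yd; rewrite [z + _]addrC subrK mul1r => h.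
have h1 := le_normcD (F y - F z - D * (y - z)) (D * (y - z)).
rewrite subrK Normc.normcM in h1.
have h2 := normc_leB (F y) (F z).
have h3 : nc (y - z) * k <= 1 by rewrite -ler_pdivlMr// mul1r ltW.
rewrite /k in h3; lra.
Qed.

End Topology.

(** * Integrability of bounded functions on a bounded set *)

Section Integral.
Context {R : realType}.
Local Open Scope ereal_scope.

(** The integral of a nonnegative function is a supremum over the simple
    functions below it, so that it is monotone even on functions whose
    measurability is not known. *)
Lemma nnintegral_le d (T : measurableType d) (mu : {measure set T -> \bar R})
    (f g : T -> \bar R) : (forall x, 0 <= f x) -> (forall x, f x <= g x) ->
  \int[mu]_x f x <= \int[mu]_x g x.
Proof.
move=> f0 fg; have g0 x : 0 <= g x by exact: le_trans (fg x).
rewrite !ge0_integralTE//; apply: le_ereal_sup => _ [h hf <-].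
by exists h => // x; exact: le_trans (hf x) (fg x).
Qed.

Lemma integral_normX_bounded (V : set R[i]^o) (p K : R) (f : R[i]^o -> R[i]^o) :
  bounded_set V -> (0 <= p)%R -> (0 <= K)%R -> (forall z, V z -> (nc (f z) <= K)%R) ->
  integral_normX V p f < +oo.
Proof.
move=> bV p0 K0 fK.
have [M0 M0' hM] := ex_strict_bound_gt0 bV.
have [M Mgt EM] := posc_real _ M0'; rewrite {}EM {M0 M0'} in hM.
pose B : set (R * R) := `[(- M)%R, M] `*` `[(- M)%R, M].
have mB : measurable B by apply: measurableX; exact: measurable_itv.
pose mu2 := (@lebesgue_measure R \x @lebesgue_measure R)%E.
apply: (@le_lt_trans _ _ (\int[mu2]_(w in B) (cst (K `^ p)%:E w))).
  rewrite /integral_normX integral_mkcond [leRHS]integral_mkcond.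
  apply: nnintegral_le => [[x y]|[x y]]; rewrite !patchE.
    by case: ifPn => // _; rewrite lee_fin powR_ge0.
  case: ifPn => [|_]; last by case: ifPn => // _; rewrite lee_fin powR_ge0.
  rewrite inE /= => Vxy; have := hM _ Vxy; rewrite /= normE ltcR => nM.
  rewrite mem_set; last first.
    rewrite /B /= !in_itv /= -!ler_norml; split; apply/ltW; apply: le_lt_trans nM.
      exact: (normc_Re (x +i* y)%C).
    exact: (normc_Im (x +i* y)%C).
  by rewrite lee_fin ge0_ler_powR ?nnegrE ?normc_ge0//; exact: fK.
have hI : lebesgue_measure `[(- M)%R, M]%classic = (M + M)%:E :> \bar R.
  by rewrite lebesgue_measure_itv /= lte_fin -subr_gt0 opprK addr_gt0// -EFinB opprK.
have muB : mu2 B = (M + M)%:E * (M + M)%:E.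
  rewrite /mu2 /B (@product_measure1E _ _ _ _ R (@lebesgue_measure R)
    (@lebesgue_measure R)); try exact: measurable_itv.
  by congr (_ * _); exact: hI.
by rewrite integral_cst// [X in _ * X < _]muB -!EFinM ltry.
Qed.

End Integral.

(** * Construction of the non-extendable function *)

Section Construction.
Context {R : realType}.
Implicit Types (Omega V : set R[i]^o).

(** A test (x, y, rho, C) stands for the estimate |a_n| <= C rho^(-n), for all n,
    of the Taylor coefficients at x + iy.  The parameters are rational or
    natural numbers to have countably many tests. *)
Definition test := (rat * rat * rat * nat)%type.
Definition center (q : test) : R[i] := (ratr q.1.1.1 +i* ratr q.1.1.2)%C.
Definition radius (q : test) : R := ratr q.1.2.
Definition level (q : test) : R := q.2%:R.

Definition admissible Omega V (w : R[i]) := ~ Omega w /\ ~ closure V w.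

(** The last condition provides a pole w for which 1 / (w - z) violates the
    estimate. *)
Definition valid Omega V (q : test) := [/\ Omega (center q), 0 < radius q &
  exists2 w, admissible Omega V w & nc (w - center q) < radius q].

Lemma expr_unbounded (q K : R) : 1 < q -> exists n, K < q ^+ n.
Proof.
move=> q1; have q0 : 0 < q - 1 by rewrite subr_gt0.
have bern n : 1 + n%:R * (q - 1) <= q ^+ n.
  elim: n => [|n IH]; first by rewrite mul0r addr0 expr0.
  have h := ler_wpM2r (ltW (lt_trans ltr01 q1)) IH.
  rewrite -exprSr in h; apply: le_trans h; rewrite -natr1.
  have : 0 <= n%:R * (q - 1) ^+ 2 by rewrite mulr_ge0 ?ler0n ?sqr_ge0.
  lra.
exists (Num.bound `|K / (q - 1)|).
apply: lt_le_trans (bern _); rewrite ltr_wpDl//.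
rewrite -ltr_pdivrMr//; apply: le_lt_trans (ler_norm _) _.
by apply: archi_boundP.
Qed.

(** The Taylor coefficient a_n of 1 / (w - z) at z0 is 1 / (w - z0)^(n+1), so
    that a_n rho^n is unbounded if |w - z0| < rho.  The bound b_k on the
    coefficients is the distance of the k-th pole from V, capped at 1; it makes
    the sum bounded by 2 on V. *)
Lemma wild_series Omega V (q0 : test) : open Omega -> valid Omega V q0 ->
  exists e w : nat -> R[i], [/\ geom_bounded 1 e, forall k, ~ Omega (w k),
    forall z, V z -> nc (simple_poles e w z) <= 2 &
    forall q, valid Omega V q -> exists n, level q * (radius q)^-1 ^+ n <
      nc (csum (fun k => e k / (w k - center q) ^+ n.+1))].
Proof.
move=> oO vq0.
(* The sequence t enumerates the valid tests; q0 fills the gaps. *)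
pose t n : test := odflt q0 (obind (fun q => if `[< valid Omega V q >] then Some q else None) (unpickle n)).
have vt n : valid Omega V (t n).
  by rewrite /t; case: (unpickle n) => //= q; case: ifPn => //= /asboolP.
have tsurj q : valid Omega V q -> exists n, t n = q.
  by move=> vq; exists (pickle q); rewrite /t pickleK /= ifT//; apply/asboolP.
have /choice[w hw] : forall k, exists w, admissible Omega V w /\ nc (w - center (t k)) < radius (t k).
  by move=> k; have [_ _ [w h1 h2]] := vt k; exists w.
have /choice[d hd] : forall m, exists d : R, 0 < d /\
    forall k, d <= nc (w k - center (t m)).
  move=> m; have [Oz _ _] := vt m; have [r r0 hr] := openc _ _ oO Oz.
  exists r; split => // k; rewrite leNgt; apply/negP => /hr.
  by have [[]] := hw k.
have /choice[b hb] : forall k, exists b : R, 0 < b /\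
    forall z, V z -> b <= nc (w k - z).
  move=> k; have [[_ ncl] _] := hw k.
  apply: contrapT => nb; apply: ncl; apply/closure_normc => r r0.
  apply: contrapT => nex; apply: nb; exists r; split => // z Vz.
  rewrite leNgt normcB; apply/negP => h; apply: nex; by exists z.
pose A m n k : R[i] := ((w k - center (t m)) ^+ n.+1)^-1.
have [||||c [cb hc]] := @gliding_hump R A
  (fun m n => level (t m) * (radius (t m))^-1 ^+ n)
  (fun m n => (d m)^-1 ^+ n.+1) (fun k => Num.min 1 (b k)).
- by move=> k; rewrite lt_min ltr01; have [] := hb k.
- move=> m n; have [_ r0 _] := vt m.
  by rewrite mulr_ge0 ?ler0n// exprn_ge0// invr_ge0 ltW.
- move=> m n k; have [d0 h] := hd m.
  rewrite /A Normc.normcV normcX -exprVn lerXn2r ?nnegrE ?invr_ge0 ?normc_ge0 ?(ltW d0)//.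
  by rewrite lef_pV2// posrE// (lt_le_trans d0).
- move=> m x x0; have [_ r0 _] := vt m; have [_ hr] := hw m.
  have [d0 /(_ m) hdm] := hd m.
  set u := nc (w m - center (t m)) in hr hdm.
  have u0 : 0 < u by exact: lt_le_trans hdm.
  have [n hn] := expr_unbounded (radius (t m) / u) (level (t m) * u / x)
    ltac:(by rewrite ltr_pdivlMr ?mul1r).
  exists n; rewrite /A Normc.normcV normcX -/u.
  have rn : 0 < radius (t m) ^+ n by rewrite exprn_gt0.
  have un : 0 < u ^+ n by rewrite exprn_gt0.
  pose y := x / u * (radius (t m))^-1 ^+ n.
  have y0 : 0 < y by rewrite mulr_gt0 ?divr_gt0// exprn_gt0// invr_gt0.
  have -> : level (t m) * (radius (t m))^-1 ^+ n = level (t m) * u / x * y.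
    by rewrite /y; field; rewrite !gt_eqF.
  have -> : x / u ^+ n.+1 = (radius (t m) / u) ^+ n * y.
    rewrite /y exprMn !exprVn exprS; field.
    by rewrite !gt_eqF.
  by rewrite ltr_pM2r.
pose e k : R[i] := (c k)%:C%C.
have ec k : nc (e k) = c k by rewrite normcR ger0_norm//; have /andP[] := cb k.
exists e, w; split.
- split => // k; rewrite ec; have /andP[_ h] := cb k; apply: le_trans h _.
  by rewrite ler_pM2r ?invr_gt0 ?exprn_gt0// ge_min lexx.
- by move=> k; have [[]] := hw k.
- move=> z Vz; rewrite -[leRHS]mulr1; apply: csum_le; split => // k.
  have [b0 /(_ z Vz) bz] := hb k; have /andP[c0 hk] := cb k.
  rewrite Normc.normcM ec Normc.normcV ler_pdivrMr; last exact: lt_le_trans bz.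
  apply: le_trans hk _; rewrite mulrAC ler_pM2r ?invr_gt0 ?exprn_gt0// mul1r.
  by apply: le_trans bz; rewrite ge_min lexx orbT.
- move=> q /tsurj[m <-]; exact: hc.
Qed.

(** Choose zeta in U on the boundary of Omega and of the component, s small
    enough for F to be bounded near the squares of half-side s centred close to
    zeta, rho <= s / 3, and a rational centre in the component and an admissible
    point both within rho / 2 of zeta. *)
Lemma extension_test Omega V (U : set R[i]^o) (F : R[i]^o -> R[i]^o) (x : R[i]) :
  open Omega -> open U -> connected U ->
  (forall zeta : R[i], closure Omega zeta -> ~ Omega zeta ->
     forall r : R, 0 < r -> exists2 w, admissible Omega V w & nc (w - zeta) < r) ->
  (U `&` Omega) x -> U `&` ~` Omega !=set0 -> holomorphic U F ->
  exists (q : test) (s m r : R),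
   [/\ valid Omega V q, 0 < s /\ radius q <= s / 3, 2 * m <= level q,
      0 < r /\ (forall y : R[i], nc (y - center q) < r ->
        connected_component (U `&` Omega) x y) &
      forall y : R[i], `|Re (y - center q)| <= s -> `|Im (y - center q)| <= s ->
       derivable F y 1 /\ nc (F y) <= m].
Proof.
move=> oO oU cU dense UOx nUO hF.
have [zeta [Uz nOz cWz]] := component_boundary _ _ _ oU cU oO UOx nUO.
set W := connected_component _ _ in cWz *.
have WUO : W `<=` U `&` Omega by apply: connected_component_sub.
have [r1 r10 hr1] := openc _ _ oU Uz.
have [r2 r20 hr2] := derivable_bounded _ _ (hF _ Uz).
pose s := Num.min r1 r2 / 4.
have s0 : 0 < s by rewrite divr_gt0// lt_min r10.
have [s1 s2] : 4 * s <= r1 /\ 4 * s <= r2.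
  have -> : 4 * s = Num.min r1 r2 by rewrite /s; field.
  by rewrite !ge_min !lexx orbT.
have [rho hrho] := rat_in_itvoo (x := 0) (y := s / 3) ltac:(lra).
move: hrho; rewrite in_itv /= => /andP[rho0 rhos].
have [y Wy yz] := (closure_normc W zeta).1 cWz (ratr rho / 4) ltac:(lra).
have oUO : open (U `&` Omega) by apply: openI.
have [r3 r30 hr3] := openc _ _ oUO (WUO _ Wy).
have hr3W := component_disc _ _ _ _ r30 Wy hr3.
have oB : open ([set z : R[i]^o | nc (z - y) < r3]).
  rewrite openE => z /= zy; apply/nbhs_normc; exists (r3 - nc (z - y)); first by rewrite subr_gt0.
  move=> z' hz' /=; have := le_normcD (z' - z) (z - y); rewrite addrA subrK; lra.
have By : [set z : R[i]^o | nc (z - y) < r3] y by rewrite /= subrr Normc.normc0.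
have [p1 [p2 [hp1 hp2]]] := rational_point _ _ oB By (ratr rho / 4) ltac:(lra).
pose q : test := (p1, p2, rho, Num.bound (2 * (nc (F zeta) + 1))).
have [r r0 hr] := openc _ _ oB hp1.
have qz : nc (center q - zeta) < ratr rho / 2.
  have := le_normcD (center q - y) (y - zeta); rewrite addrA subrK.
  rewrite -/(center q) in hp2; lra.
have clz : closure Omega zeta by apply: closureS cWz => t /WUO[].
have [w hw wz] := dense zeta clz nOz (ratr rho / 2) ltac:(lra).
exists q, s, (nc (F zeta) + 1), r; split.
- split => //=; first by have [] := WUO _ (hr3W _ hp1).
  exists w => //; have := le_normcD (w - zeta) (zeta - center q); rewrite addrA subrK.
  rewrite [nc (zeta - _)]normcB /radius /=; lra.
- by split => //; rewrite /radius /=; exact: ltW.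
- by rewrite /level /=; apply: ltW; apply: archi_boundP; rewrite mulr_ge0// addr_ge0// normc_ge0.
- by split => // t /hr; exact: hr3W.
move=> t h1 h2; have tz : nc (t - zeta) < 4 * s.
  have := le_normcD (t - center q) (center q - zeta); rewrite addrA subrK.
  have := normc_le_ReIm (t - center q); lra.
by split; [apply: hF; apply: hr1; exact: lt_le_trans s1|apply: hr2; exact: lt_le_trans s2].
Qed.

End Construction.

Theorem mainTheorem5 (R : realType) (Omega V : set R[i]^o) (p : R)
    (hOmega : is_domain Omega)
    (hVOmega : V `<=` Omega) (hVopen : open V) (hVbounded : bounded_set V)
    (hp : 1 <= p)
    (hzeta : forall zeta : R[i]^o, (closure V `&` boundary Omega) zeta ->
       forall e : R, 0 < e ->
         exists2 w : R[i]^o, (~` closure Omega) w & `|w - zeta| < (e%:C)%C) :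
  domain_of_holomorphy Omega (Y Omega V p).
Proof.
have [_ oO _] := hOmega; have p0 : 0 <= p := le_trans ler01 hp.
have dense (zeta : R[i]) : closure Omega zeta -> ~ Omega zeta ->
     forall r : R, 0 < r -> exists2 w, admissible Omega V w & nc (w - zeta) < r.
  move=> clz nOz r r0; have [cV|ncV] := pselect (closure V zeta); last first.
    by exists zeta; rewrite ?subrr ?Normc.normc0.
  have bz : boundary Omega zeta by split => // /interior_subset.
  have [w ncw wz] := hzeta zeta (conj cV bz) r r0.
  exists w; last by move: wz; rewrite normE ltcR.
  by split=> h; apply: ncw; [exact: subset_closure|exact: closureS h].
have key (f : R[i]^o -> R[i]^o) : holomorphic Omega f ->
    (forall z, V z -> nc (f z) <= 2) -> ~ extendable Omega f ->
    domain_of_holomorphy Omega (Y Omega V p).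
  move=> hf fV nf; exists f => //; split => //.
  by apply: (integral_normX_bounded V p 2 f).
have [[q0 vq0]|nv] := pselect (exists q, valid Omega V q); last first.
  apply: (key (fun=> 0)).
  - by move=> z _; apply: derivable_cst.
  - by move=> z _; rewrite Normc.normc0.
  move=> [U [F [W [[oU cU] [_ nUO] hF [x UOx _] _]]]]; apply: nv.
  by have [q [s [m [r [vq _ _ _ _]]]]] := extension_test _ V _ _ _ oO oU cU dense UOx nUO hF; exists q.
have [e [w [ge wO fV wild]]] := wild_series _ _ _ oO vq0.
apply: (key (simple_poles e w)) => // [z Oz|].
  have [r r0 hr] := openc _ _ oO Oz.
  apply: (simple_poles_derivable e w z 1 (r / 2) (r / 2)) => //; try lra.
  move=> k y yz; rewrite leNgt; apply/negP => h; apply: (wO k); apply: hr.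
  have := le_normcD (w k - y) (y - z); rewrite addrA subrK; lra.
move=> [U [F [W [[oU cU] [_ nUO] hF [x UOx ->] Ff]]]].
have [q [s [m [r [vq [s0 rs] mq [r0 hr] hsq]]]]] :=
  extension_test _ V _ _ _ oO oU cU dense UOx nUO hF.
have [n] := wild q vq; apply/negP; rewrite -leNgt.
have WO y : connected_component (U `&` Omega) x y -> Omega y.
  by move=> /connected_component_sub[].
have far k y : nc (y - center q) < r / 2 -> r / 2 <= nc (w k - y).
  move=> yz; rewrite leNgt; apply/negP => h; apply: (wO k); apply: WO; apply: hr.
  have := le_normcD (w k - y) (y - center q); rewrite addrA subrK; lra.
have r2 : 0 < r / 2 by lra.
have cF : continues w (center q) (r / 2) s F e m.
  split=> [z zr|z h1 h2|z h1 h2 _]; try by have [] := hsq z h1 h2.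
  by rewrite Ff//; apply: hr; lra.
apply: le_trans (taylor_coefficient_le w (center q) (r / 2) (r / 2) s r2 r2 s0 far n F e 1 m ge cF) _.
have [_ rho0 _] := vq.
have m0 : 0 <= m.
  have [|//|_] := hsq (center q); rewrite ?subrr /= ?normr0 ?(ltW s0)//.
  exact: le_trans (normc_ge0 _).
apply: ler_pM => //; first by rewrite mulr_ge0.
  by rewrite exprn_ge0// divr_ge0// ltW.
rewrite lerXn2r ?nnegrE ?divr_ge0 ?invr_ge0 ?(ltW s0) ?(ltW rho0)//.
by rewrite -[3 / s]invf_div lef_pV2// posrE divr_gt0.
Qed.
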